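(* Consider a directed graph (known topology) on $\{1,\dots,L\}$ and a set $\mathcal C$ of measured nodes. For every node $i$, one can generically uniquely identify all transfer functions on the edges leaving $i$ if and only if there exist $d_i^+$ vertex-disjoint directed paths, one leaving each of the $d_i^+$ out-neighbors of $i$, and arriving at measured nodes (vertex-disjointness applies also to the departure and arrival nodes). In particular, it holds generically that $CT^0(I-G)=C$ with $G$ consistent with the graph implies $G=G^0$ if and only if the condition above is satisfied for every node $i$.
   Context: Network: a directed graph without self-loops on $\{1,\dots,L\}$, whose topology is known, together with an $L\times L$ matrix $G^0(q)$ of proper real rational transfer functions. $G^0_{ij}$ is the transfer function of the edge from node $j$ to node $i$. A matrix $G$ of proper rational transfer functions is consistent with the graph if $G_{ij}=0$ whenever there is no edge from $j$ to $i$; $G^0$ is consistent with the graph, there is a delay in every cycle, and $I-G^0$ is invertible with $(I-G^0)^{-1}$ proper and stable; $T^0=(I-G^0)^{-1}$. The node signals satisfy $w=G^0w+r$, $y=Cw$, where every node is excited by a known, sufficiently rich signal $r_i$ (mutually uncorrelated), and $C$ is the $p\times L$ selection matrix ($0/1$, one $1$ per row) of the set $\mathcal C$ of $p$ measured nodes. Thus $CT^0$ is known exactly. For a given $G^0$, all transfer functions on the edges leaving $i$ can be uniquely identified if $G_{ki}=G^0_{ki}$ for all $k\in N_i^+$ and every $G$ consistent with the graph and satisfying $CT^0(I-G)=C$. A property holds generically if it holds for almost all choices of $G^0$ consistent with the graph: there is a nonzero real polynomial in variables indexed by the edges such that the property holds for every admissible $G^0$ for which this polynomial, evaluated at the edge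 transfer functions, is not the zero function. $N_i^+$ is the set of out-neighbors of $i$ (nodes $k$ with an edge from $i$ to $k$), and $d_i^+=|N_i^+|$. A path is a walk along directed edges that never passes twice through the same node; a single node is a (trivial) path. *)

(* Defs.v *)
From mathcomp Require Export all_boot all_order all_algebra.
From mathcomp Require Export reals complex mpoly.

Set Implicit Arguments.
Unset Strict Implicit.
Unset Printing Implicit Defensive.

Import Order.TTheory GRing.Theory Num.Theory.
Local Open Scope ring_scope.

(* Real rational functions; the polynomial variable 'X stands for the forward
   shift operator q. *)
Definition tfun (R : realType) := {fraction {poly R}}.

Definition proper_tf (R : realType) (f : tfun R) : Prop :=
  exists n d : {poly R},
    [/\ d != 0, f = tofrac n / tofrac d & (size n <= size d)%N].

(* Strictly proper, i.e. f contains a delay.  The zero function is strictly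
   proper: take n = 0 and d = 1. *)
Definition strictly_proper_tf (R : realType) (f : tfun R) : Prop :=
  exists n d : {poly R},
    [/\ d != 0, f = tofrac n / tofrac d & (size n < size d)%N].

(* Discrete-time stability: all complex poles, i.e. all complex roots of the
   denominator in lowest terms, lie in the open unit disc. *)
Definition stable_tf (R : realType) (f : tfun R) : Prop :=
  exists n d : {poly R},
    [/\ d != 0, coprimep n d, f = tofrac n / tofrac d
      & forall z : R[i], root (map_poly (real_complex R) d) z -> `|z| < 1].

(* A graph is given by e : rel 'I_L, where e j i means that there is an edge
   from j to i; the transfer function of that edge is the entry G i j. *)
Definition consistent (R : realType) (L : nat) (e : rel 'I_L)
    (G : 'M[tfun R]_L) : Prop :=
  (forall i j, proper_tf (G i j)) /\ (forall i j, ~~ e j i -> G i j = 0).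

Definition delay_in_cycles (R : realType) (L : nat) (e : rel 'I_L)
    (G : 'M[tfun R]_L) : Prop :=
  forall c : seq 'I_L, c != [::] -> ucycle e c ->
    exists2 j, j \in c & strictly_proper_tf (G (next c j) j).

Definition closed_loop (R : realType) (L : nat) (G : 'M[tfun R]_L) :
  'M[tfun R]_L := invmx (1%:M - G).

Definition admissible (R : realType) (L : nat) (e : rel 'I_L)
    (G : 'M[tfun R]_L) : Prop :=
  [/\ consistent e G, delay_in_cycles e G, 1%:M - G \in unitmx
    & forall i j, proper_tf (closed_loop G i j) /\ stable_tf (closed_loop G i j)].

Definition selection_mx (R : realType) (L : nat) (C : {set 'I_L}) :
  'M[tfun R]_(#|C|, L) := \matrix_(k, j) (enum_val k == j)%:R.

Definition explains (R : realType) (L : nat) (C : {set 'I_L})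
    (G0 G : 'M[tfun R]_L) : Prop :=
  selection_mx R C *m closed_loop G0 *m (1%:M - G) = selection_mx R C.

Definition out_nbrs (L : nat) (e : rel 'I_L) (i : 'I_L) : {set 'I_L} :=
  [set k | e i k].

Definition identifiable_from (R : realType) (L : nat) (e : rel 'I_L)
    (C : {set 'I_L}) (i : 'I_L) (G0 : 'M[tfun R]_L) : Prop :=
  forall G : 'M[tfun R]_L, consistent e G -> explains C G0 G ->
    forall k, k \in out_nbrs e i -> G k i = G0 k i.

Definition identifiable (R : realType) (L : nat) (e : rel 'I_L)
    (C : {set 'I_L}) (G0 : 'M[tfun R]_L) : Prop :=
  forall G : 'M[tfun R]_L, consistent e G -> explains C G0 G -> G = G0.

Definition edges (L : nat) (e : rel 'I_L) : {set 'I_L * 'I_L} :=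
  [set x | e x.1 x.2].

(* p has one variable per edge; the variable of the edge (j, i) takes the
   value G i j. *)
Definition eval_edges (R : realType) (L : nat) (e : rel 'I_L)
    (p : {mpoly R[#|edges e|]}) (G : 'M[tfun R]_L) : tfun R :=
  mmap (fun a : R => tofrac (a%:P))
    (fun x : 'I_#|edges e| => G (enum_val x).2 (enum_val x).1) p.

Definition generically (R : realType) (L : nat) (e : rel 'I_L)
    (P : 'M[tfun R]_L -> Prop) : Prop :=
  exists p : {mpoly R[#|edges e|]}, p != 0 /\
    forall G : 'M[tfun R]_L, admissible e G -> eval_edges p G != 0 -> P G.

(* The path starting at k in S is k :: s k; a trivial path has s k = [::].
   Values of s outside S are irrelevant. *)
Definition disjoint_paths (L : nat) (e : rel 'I_L) (S C : {set 'I_L}) : Prop :=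
  exists s : 'I_L -> seq 'I_L,
    (forall k, k \in S ->
       [/\ path e k (s k), uniq (k :: s k) & last k (s k) \in C]) /\
    (forall k l, k \in S -> l \in S -> k != l ->
       [disjoint k :: s k & l :: s l]).

(* Main.v *)
Require Import Defs.
From mathcomp Require Import perm generic_quotient.
Set Implicit Arguments.
Unset Strict Implicit.
Unset Printing Implicit Defensive.
Import Order.TTheory GRing.Theory Num.Theory.
Local Open Scope ring_scope.

(** Fix a node [i], let [N] be its set of out-neighbors, and let [D] be the
    difference between a candidate network [G] and the true network [G0].
    Since [closed_loop G0] inverts [1 - G0], the equation [explains C G0 G]
    says that [u = closed_loop G0 *m D] vanishes on the rows in [C]
    ([explains_kerE]).  Column [i] of [D] is supported on [N], and it is
    [(1 - G0) *m u] for the column [u] of that product.  So the edges leaving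
    [i] are identifiable iff the only vector [u] that vanishes on [C] and for
    which [(1 - G0) *m u] vanishes off [N] is [u = 0]; a nonzero solution with
    improper entries can be multiplied by a high power of the delay.  This is
    a rank condition on the matrix [test_mx N C G0], whose entries are affine
    in the edge transfer functions: no inverse occurs in it.
    [full_identifiable_from] and [identifiable_from_full] are the two
    directions.

    Both sides of the equivalence with disjoint paths come from maximal minors
    of [test_mx].  If the matrix has full column rank at one point, some
    maximal minor is nonzero, hence so is one term of its Leibniz expansion.
    That term matches every node [j], injectively, either with a row [r]
    outside [N] such that [r = j] or [j -> r] is an edge, or with the row of
    [C] that selects [j].  Follow the matching from a node of [N] until it
    reaches a selecting row: no step enters [N] and steps are injective, so
    the walk is a simple path that ends in [C], and walks from different nodes
    never meet ([full_test_mx_paths]).  This plays the role of the theorem of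
    Menger.  Conversely, when disjoint paths exist, put weight one on their
    edges and zero elsewhere: along each path the value of a kernel vector
    propagates backwards from the measured end, where it is zero, so the rank
    is full ([path_mx_full]).  The minor that is nonzero at this point, read
    as a polynomial in the edges, certifies the rank generically
    ([paths_generically_full]).

    Genericity would be vacuous if a nonzero polynomial could vanish at all
    admissible networks.  It does not, by [generic_point]: take [G = A / q]
    with [A] a real matrix with small entries.  There is a delay on every edge
    and the closed-loop poles are eigenvalues of [A], which lie in the open
    unit disc; and a small [A] can be chosen off the zero set of the
    polynomial. *)

(** * The rank condition *)

(** A vector is in the kernel iff it vanishes on [C] and its image under
    [1 - G] vanishes off [N]; see [test_mx_kerE].  The rows in [N] are replaced
    by zero rather than removed, which keeps the row index independent of
    [N] and [C]. *)
Definition test_mx (K : pzRingType) (L : nat) (N C : {set 'I_L})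
    (G : 'M[K]_L) : 'M[K]_(L + L, L) :=
  col_mx (\matrix_(r, j) if r \in N then 0 else (1%:M - G) r j)
         (\matrix_(c, j) ((c \in C) && (c == j))%:R).

Lemma row_full_kerP (K : fieldType) (m n : nat) (A : 'M[K]_(m, n)) :
  reflect (forall u : 'cV_n, A *m u = 0 -> u = 0) (row_full A).
Proof.
apply: (iffP idP) => [/row_fullP[B BA] u Au|inj].
  by rewrite -[u]mul1mx -BA -mulmxA Au mulmx0.
rewrite -cokermx_eq0; apply/eqP/trmx_inj/row_matrixP => j.
rewrite -tr_col trmx0 row0 (inj (col j (cokermx A))) ?trmx0 //.
by rewrite colE mulmxA mulmx_coker mul0mx.
Qed.

Lemma test_mx_kerE (K : pzRingType) (L : nat) (N C : {set 'I_L}) (G : 'M[K]_L)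
    (u : 'cV[K]_L) :
  test_mx N C G *m u = 0 <->
  (forall r, r \notin N -> ((1%:M - G) *m u) r 0 = 0) /\
  (forall c, c \in C -> u c 0 = 0).
Proof.
have bot c : (\matrix_(c, j) ((c \in C) && (c == j))%:R *m u) c 0
    = if c \in C then u c 0 else 0.
  rewrite mxE (bigD1 c) //= big1 ?addr0 => [|j /negPf jc]; rewrite mxE.
    by rewrite eqxx andbT; case: (c \in C); rewrite ?mul1r ?mul0r.
  by rewrite eq_sym jc andbF mul0r.
have top r : (\matrix_(r, j) (if r \in N then 0 else (1%:M - G) r j) *m u) r 0
    = if r \in N then 0 else ((1%:M - G) *m u) r 0.
  rewrite mxE; case: ifP => rN.
    by rewrite big1 // => j _; rewrite mxE rN mul0r.
  by rewrite [RHS]mxE; apply: eq_bigr => j _; rewrite mxE rN.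
rewrite /test_mx mul_col_mx -[X in _ = X]col_mx0.
split=> [/eq_col_mx[t0 b0]|[u1 u2]].
  split=> [r rN|c cC].
    by have := top r; rewrite t0 (negPf rN) mxE.
  by have := bot c; rewrite b0 cC mxE.
congr col_mx; apply/colP => r; rewrite ?top ?bot [RHS]mxE.
  by case: ifPn => // /u1.
by case: ifPn => // /u2.
Qed.

Lemma map_test_mx (K1 K2 : pzRingType) (f : {rmorphism K1 -> K2}) (L : nat)
    (N C : {set 'I_L}) (G : 'M[K1]_L) :
  map_mx f (test_mx N C G) = test_mx N C (map_mx f G).
Proof.
rewrite /test_mx map_col_mx; congr col_mx; apply/matrixP => i j; rewrite !mxE.
  by case: ifP => _; rewrite ?rmorph0 // rmorphB rmorph_nat.
by rewrite rmorph_nat.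
Qed.

(** * Disjoint paths from a nonzero minor *)

(** Two walks that meet can be traced back step by step, by injectivity.  If
    one of them ran out first, its starting point, which is in [N], would be a
    value of [h]; so both start together. *)
Lemma iter_start_unique (T : eqType) (h : T -> T) (stop : pred T) (N : pred T)
    (h_inj : forall x y, ~~ stop x -> ~~ stop y -> h x = h y -> x = y)
    (hN : forall x, ~~ stop x -> ~~ N (h x)) (k l : T) (a b : nat) :
  N k -> N l ->
  (forall t, (t < a)%N -> ~~ stop (iter t h k)) ->
  (forall t, (t < b)%N -> ~~ stop (iter t h l)) ->
  iter a h k = iter b h l -> a = b /\ k = l.
Proof.
move=> Nk Nl; elim: a b => [|a IH] [|b] //= ka lb eqab.
- by have := hN _ (lb b (ltnSn b)); rewrite -eqab Nk.
- by have := hN _ (ka a (ltnSn a)); rewrite eqab Nl.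
have [//|||-> ->//] := IH b.
- by move=> t ta; apply: ka; apply: ltnW.
- by move=> t tb; apply: lb; apply: ltnW.
by apply: h_inj (eqab); [apply: ka | apply: lb].
Qed.

(** The value [inl r] means that the walk moves from [j] to [r], and [inr c]
    that it stops at [j].  A loop [r = j] is allowed in the hypothesis, but no
    walk that starts in [N] meets one, because it would visit [j] twice. *)
Lemma paths_of_injection (L : nat) (e : rel 'I_L) (N C : {set 'I_L})
    (g : 'I_L -> 'I_L + 'I_L) :
  injective g ->
  (forall j r, g j = inl r -> r \notin N /\ (r = j \/ e j r)) ->
  (forall j c, g j = inr c -> j \in C) ->
  disjoint_paths e N C.
Proof.
move=> g_inj g_inl g_inr.
pose stop j := if g j is inr _ then true else false.
pose h j := if g j is inl r then r else j.
have goE j : ~~ stop j -> g j = inl (h j) by rewrite /stop /h; case: (g j).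
have h_inj x y : ~~ stop x -> ~~ stop y -> h x = h y -> x = y.
  by move=> /goE gx /goE gy hxy; apply: g_inj; rewrite gx gy hxy.
have hN x : ~~ stop x -> h x \notin N by move=> /goE /g_inl[].
have meet := iter_start_unique h_inj hN.
(* A walk that never stops would visit L + 1 distinct nodes.  The implication
   makes the statement true for all k, so that T below is a total function. *)
have stops k : exists t, (k \in N) ==> stop (iter t h k).
  case: (boolP (k \in N)) => [kN|_]; last by exists 0%N.
  case: (boolP [exists t : 'I_L.+1, stop (iter t h k)]).
    by case/existsP=> t; exists t.
  rewrite negb_exists => /forallP alive.
  have inj : injective (fun t : 'I_L.+1 => iter t h k).
    move=> t t' tt'; apply: val_inj => /=.
    have below (s : 'I_L.+1) a : (a < s)%N -> ~~ stop (iter a h k).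
      move=> a_s; have aL : (a < L.+1)%N by apply: ltn_trans a_s (ltn_ord s).
      exact: alive (Ordinal aL).
    by have [] := meet k k t t' kN kN (below t) (below t') tt'.
  by have := leq_card _ inj; rewrite !card_ord ltnn.
pose T k := ex_minn (stops k).
have T_stop k : k \in N -> stop (iter (T k) h k).
  by rewrite /T; case: ex_minnP => m /implyP.
have T_go k t : (t < T k)%N -> ~~ stop (iter t h k).
  rewrite /T; case: ex_minnP => m _ m_min tm; apply/negP => st.
  by have := m_min t; rewrite st implybT leqNgt tm => /(_ isT).
pose s k := traject h (h k) (T k).
have sE k : k :: s k = traject h k (T k).+1 by [].
have meetT k l a b : k \in N -> l \in N -> (a <= T k)%N -> (b <= T l)%N ->
    iter a h k = iter b h l -> a = b /\ k = l.
  move=> kN lN aT bT; apply: meet => // t tt; apply: T_go.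
    exact: leq_trans aT.
  exact: leq_trans bT.
exists s; split=> [k kN|k l kN lN kl]; last first.
  rewrite !sE disjoint_has; apply/hasPn => x /trajectP[a aT ->].
  apply/negP => /trajectP[b bT] /meetT[] // _ /eqP; exact/negP.
split.
- apply/(pathP k) => t; rewrite size_traject => tT.
  have go := T_go _ _ tT; rewrite sE nth_traject; last exact: ltnW.
  rewrite (set_nth_default (h k)) ?size_traject // nth_traject // -iterSr iterS.
  have [_ [same|//]] := g_inl _ _ (goE _ go).
  have [/esym/eqP] := meetT k k t t.+1 kN kN (ltnW tT) tT (esym same).
  by rewrite gtn_eqF.
- rewrite sE; apply/(uniqP k) => a b; rewrite !inE size_traject => aT bT.
  by rewrite !nth_traject // => /meetT[].
- rewrite /s last_traject.
  move: (T_stop k kN); rewrite /stop.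
  by case gk: (g _) => [//|c] _; apply: g_inr gk.
Qed.

(** A nonzero term in the Leibniz expansion of a nonzero maximal minor is an
    injection as in [paths_of_injection]. *)
Lemma full_test_mx_paths (K : fieldType) (L : nat) (e : rel 'I_L)
    (N C : {set 'I_L}) (G : 'M[K]_L) :
  (forall i j, ~~ e j i -> G i j = 0) ->
  row_full (test_mx N C G) -> disjoint_paths e N C.
Proof.
move=> G0 full; have := fullrowsub_unit full.
rewrite unitmxE unitfE /determinant => det_neq0.
have [s s_neq0] : exists s : 'S_L,
    \prod_i (rowsub (fullrankfun full) (test_mx N C G)) i (s i) != 0.
  apply/existsP; apply: contraR det_neq0; rewrite negb_exists => /forallP s0.
  rewrite big1 // => s _; have := s0 s; rewrite negbK => /eqP ->.
  by rewrite mulr0.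
(* The permutation s sends a row of the minor to a column; read backwards, it
   gives each node its row in the full matrix. *)
pose g j := split (fullrankfun full (s^-1%g j)).
have entry j : test_mx N C G (unsplit (g j)) j != 0.
  move/prodf_neq0: s_neq0 => /(_ (s^-1%g j) isT).
  by rewrite mxE permKV /g splitK.
apply: (@paths_of_injection L e N C g).
- by move=> i j /(can_inj splitK) /fullrankfun_inj /perm_inj.
- move=> j r gj; have := entry j; rewrite gj /= col_mxEu mxE.
  case: ifPn => [_|rN]; first by rewrite eqxx.
  rewrite !mxE => nz; split=> //.
  have [->|rj] := eqVneq r j; [by left|right].
  apply: contraNT nz => /G0 ->; rewrite subr0 (negPf rj); exact: eqxx.
- move=> j c gj; have := entry j; rewrite gj /= col_mxEd mxE.
  have [->|_] := eqVneq c j; last by rewrite andbF eqxx.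
  by rewrite andbT; case: (j \in C) => //; rewrite eqxx.
Qed.

(** * Full rank from disjoint paths *)

(** The entry [(r, j)] is 1 iff [j] precedes [r] on one of the paths: the node
    at position [t] in [s k] is at position [t.+1] in [k :: s k]. *)
Definition path_mx (K : pzRingType) (L : nat) (N : {set 'I_L})
    (s : 'I_L -> seq 'I_L) : 'M[K]_L :=
  \matrix_(r, j) [exists k in N,
    (r \in s k) && (j == nth k (k :: s k) (index r (s k)))]%:R.

Lemma path_mx_edge (K : pzRingType) (L : nat) (e : rel 'I_L) (N : {set 'I_L})
    (s : 'I_L -> seq 'I_L) :
  (forall k, k \in N -> path e k (s k)) ->
  forall i j, ~~ e j i -> path_mx K N s i j = 0.
Proof.
move=> paths i j; rewrite mxE; case: existsP => // -[k].
case/and3P=> kN ri /eqP ->; have /(pathP k)/(_ (index i (s k))) := paths k kN.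
by rewrite index_mem ri nth_index // => ->.
Qed.

(** By disjointness and simplicity, a path meets [N] only at its start.  So if
    [u] is in the kernel, the equation [u = path_mx *m u] holds at all later
    nodes of a path and makes [u] constant along it; the constant is 0 because
    the end is in [C].  Off the paths and off [N] the rows of [path_mx] are
    zero. *)
Lemma path_mx_full (K : fieldType) (L : nat) (e : rel 'I_L)
    (N C : {set 'I_L}) (s : 'I_L -> seq 'I_L) :
  (forall k, k \in N ->
     [/\ path e k (s k), uniq (k :: s k) & last k (s k) \in C]) ->
  (forall k l, k \in N -> l \in N -> k != l ->
     [disjoint k :: s k & l :: s l]) ->
  row_full (test_mx N C (path_mx K N s)).
Proof.
move=> sP s_disj; apply/row_full_kerP => u /test_mx_kerE[u_eq u_C].
have same k l x : k \in N -> l \in N -> x \in k :: s k -> x \in l :: s l ->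
    k = l.
  move=> kN lN xk xl; apply/eqP; apply: contraT => kl.
  by have /disjointFr/(_ xk) := s_disj _ _ kN lN kl; rewrite xl.
have off k x : k \in N -> x \in s k -> x \notin N.
  move=> kN xs; apply/negP => xN.
  have xk : x = k.
    by apply: (same _ _ x); rewrite // inE ?eqxx // xs orbT.
  by have [_ /= /andP[]] := sP k kN; rewrite -xk xk -{1}xk xs.
have uE r : r \notin N -> u r 0 = \sum_j path_mx K N s r j * u j 0.
  move=> /u_eq; rewrite mulmxBl mul1mx !mxE => /eqP.
  by rewrite subr_eq0 => /eqP.
have prev k t : k \in N -> (t < size (s k))%N ->
    u (nth k (k :: s k) t) 0 = u (nth k (k :: s k) t.+1) 0.
  move=> kN ts; have rs : nth k (s k) t \in s k by apply: mem_nth.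
  rewrite [RHS]uE ?(off k) // (bigD1 (nth k (k :: s k) t)) //=.
  have [_ /andP[_ uniq_s] _] := sP k kN.
  rewrite big1 => [|j jt]; rewrite mxE.
    rewrite addr0 (_ : [exists _ in _, _]) ?mul1r //.
    by apply/existsP; exists k; rewrite kN rs index_uniq ?eqxx.
  case: existsP => [[l /and3P[lN rl /eqP jE]]|_]; last by rewrite mul0r.
  have kl : k = l.
    apply: (same k l (nth k (s k) t)) => //; rewrite inE.
      by rewrite rs orbT.
    by rewrite rl orbT.
  by move: jt; rewrite jE -kl index_uniq // eqxx.
have on k t : k \in N -> (t <= size (s k))%N -> u (nth k (k :: s k) t) 0 = 0.
  (* Induction on the distance n to the end of the path. *)
  move=> kN ts; rewrite -(subKn ts); move: (_ - t)%N => n.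
  elim: n => [|n IH].
    rewrite subn0 -[size _]/(size (k :: s k)).-1 nth_last /=.
    by apply: u_C; have [] := sP k kN.
  have [ns|ns] := ltnP n (size (s k)); last first.
    by move: IH; rewrite (eqP ns) (eqP (leqW ns)).
  by rewrite prev // ?subnSK ?leq_subr.
have on_mem k x : k \in N -> x \in k :: s k -> u x 0 = 0.
  by move=> kN /(nthP k)[t tk <-]; apply: on.
apply/colP => r; rewrite [RHS]mxE.
have [rN|rN] := boolP (r \in N); first by apply: (on_mem r); rewrite ?inE ?eqxx.
rewrite uE // big1 // => j _; rewrite mxE.
case: existsP => [[k /and3P[kN rs /eqP ->]]|_]; last by rewrite mul0r.
by rewrite (on_mem k) ?mulr0 // mem_nth //= ltnS index_size.
Qed.

(** * Identifiability is the rank condition *)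

Lemma fraction_repr (D : idomainType) (f : {fraction D}) :
  exists n d : D, d != 0 /\ f = tofrac n / tofrac d.
Proof.
elim/quotW: f => x; exists (frac x).1, (frac x).2.
split; first exact: denom_ratioP.
apply: canRL (mulfK _) _; first by rewrite tofrac_eq0 denom_ratioP.
rewrite /tofrac; unlock FracField.tofrac; rewrite -[LHS]FracField.pi_mul.
apply/eqmodP; rewrite /= FracField.equivfE /FracField.mulf /=.
rewrite !numden_Ratio ?mulf_neq0 ?oner_eq0 ?denom_ratioP //.
by rewrite !mulr1 mulrC.
Qed.

Lemma proper_tfD (R : realType) (f g : tfun R) :
  proper_tf f -> proper_tf g -> proper_tf (f + g).
Proof.
move=> [n1 [d1 [d1n0 -> le1]]] [n2 [d2 [d2n0 -> le2]]].
exists (n1 * d2 + n2 * d1), (d1 * d2); split; first by rewrite mulf_neq0.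
  by rewrite tofracD !tofracM addf_div ?tofrac_eq0.
rewrite (size_mul d1n0 d2n0); apply: leq_trans (size_polyD _ _) _.
rewrite geq_max; apply/andP; split; apply: leq_trans (size_polyMleq _ _) _.
  by rewrite -!subn1 leq_sub2r // leq_add2r.
by rewrite addnC -!subn1 leq_sub2r // leq_add2l.
Qed.

(** Dividing by a high power of ['X] makes finitely many fractions proper. *)
Lemma proper_scaling (R : realType) (I : finType) (f : I -> tfun R) :
  exists2 s : tfun R, s != 0 & forall i, proper_tf (s * f i).
Proof.
have [n nE] := fin_all_exists (fun i => fraction_repr (f i)).
have [d fE] := fin_all_exists nE.
pose D : {poly R} := 'X^(\max_i size (n i)).
have D0 : D != 0 by rewrite monic_neq0 ?monicXn.
exists (tofrac D)^-1; first by rewrite invr_eq0 tofrac_eq0.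
move=> i; have [d0 ->] := fE i; exists (n i), (D * d i).
rewrite mulf_neq0 //; split=> //.
  by rewrite tofracM invfM mulrCA mulrA [_ * _^-1]mulrC mulrCA mulrA.
rewrite size_mul // size_polyXn addSn /=.
by apply: leq_trans (leq_addr _ _); apply: leq_bigmax.
Qed.

(** [G0] explains the data itself, so subtracting the two equations leaves the
    linear condition that the measured rows of [closed_loop G0 *m (G - G0)]
    are zero. *)
Lemma explains_kerE (R : realType) (L : nat) (C : {set 'I_L})
    (G0 G : 'M[tfun R]_L) :
  1%:M - G0 \in unitmx ->
  explains C G0 G <->
  forall i c, c \in C -> (closed_loop G0 *m (G - G0)) c i = 0.
Proof.
move=> uG0; rewrite /explains.
have -> : 1%:M - G = (1%:M - G0) - (G - G0) by rewrite opprB addrA subrK.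
rewrite mulmxBr -[X in X - _]mulmxA mulVmx // mulmx1 -mulmxA.
set U := closed_loop G0 *m _.
have selE k i : (selection_mx R C *m U) k i = U (enum_val k) i.
  rewrite mxE (bigD1 (enum_val k)) //= mxE eqxx mul1r big1 ?addr0 // => j jk.
  by rewrite mxE eq_sym (negPf jk) mul0r.
split=> [/eqP|U0].
  rewrite -subr_eq0 addrC addKr oppr_eq0 => /eqP SU i c cC.
  by rewrite -[c](enum_rankK_in cC) // -selE SU mxE.
rewrite (_ : _ *m U = 0) ?subr0 //; apply/matrixP => k i.
by rewrite selE U0 ?mxE // enum_valP.
Qed.

Lemma full_identifiable_from (R : realType) (L : nat) (e : rel 'I_L)
    (C : {set 'I_L}) (i : 'I_L) (G0 : 'M[tfun R]_L) :
  1%:M - G0 \in unitmx -> consistent e G0 ->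
  row_full (test_mx (out_nbrs e i) C G0) -> identifiable_from e C i G0.
Proof.
move=> uG0 [_ G0_e] /row_full_kerP full G [_ G_e] /(explains_kerE _ _ uG0) GC.
pose D := G - G0; pose u := closed_loop G0 *m col i D.
have uD : (1%:M - G0) *m u = col i D by rewrite mulmxA mulmxV ?mul1mx.
have u0 : u = 0.
  apply/full/test_mx_kerE; split=> [r|c cC].
    by rewrite inE uD !mxE => er; rewrite G_e // G0_e // subr0.
  by rewrite -(GC i c cC) /u colE mulmxA -colE mxE.
move=> k _; apply/eqP; rewrite -subr_eq0.
have := congr1 (fun v : 'cV_L => v k 0) uD.
by rewrite u0 mulmx0 !mxE => <-.
Qed.

(** A nonzero kernel vector [u] gives a second explanation: add
    [(1 - G0) *m u], scaled to be proper, to column [i] of [G0]. *)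
Lemma identifiable_from_full (R : realType) (L : nat) (e : rel 'I_L)
    (C : {set 'I_L}) (i : 'I_L) (G0 : 'M[tfun R]_L) :
  1%:M - G0 \in unitmx -> consistent e G0 ->
  identifiable_from e C i G0 -> row_full (test_mx (out_nbrs e i) C G0).
Proof.
move=> uG0 [G0_proper G0_e] ident; apply/row_full_kerP => u.
case/test_mx_kerE=> u_N u_C; set v := (1%:M - G0) *m u in u_N.
have uE : u = closed_loop G0 *m v by rewrite mulmxA mulVmx ?mul1mx.
suff v0 : v = 0 by rewrite uE v0 mulmx0.
have [s s0 sv_proper] := proper_scaling (fun k => v k 0).
pose G := G0 + s *: (v *m delta_mx 0 i).
have GE k j : G k j = if j == i then G0 k i + s * v k 0 else G0 k j.
  rewrite !mxE big_ord1 !mxE eqxx /=.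
  by case: eqP => [->|_]; rewrite ?mulr1 // !mulr0 addr0.
have Gcons : consistent e G.
  split=> k j; rewrite GE; have [ji|_] := eqVneq j i.
  - exact: proper_tfD.
  - exact: G0_proper.
  - by rewrite ji => eik; rewrite G0_e // u_N ?inE // mulr0 addr0.
  - exact: G0_e.
have Gexp : explains C G0 G.
  apply/explains_kerE => // j c cC.
  rewrite addrC addKr -scalemxAr mulmxA -uE !mxE big_ord1 u_C //.
  by rewrite mul0r mulr0.
apply/colP => k; rewrite [RHS]mxE.
have [kN|/u_N//] := boolP (k \in out_nbrs e i).
have := ident G Gcons Gexp k kN; rewrite GE eqxx => /eqP.
by rewrite -subr_eq0 addrC addKr mulf_eq0 (negPf s0) => /eqP.
Qed.

Lemma identifiable_columns (R : realType) (L : nat) (e : rel 'I_L)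
    (C : {set 'I_L}) (G0 : 'M[tfun R]_L) :
  consistent e G0 ->
  (identifiable e C G0 <-> forall i, identifiable_from e C i G0).
Proof.
move=> [_ G0_e]; split=> [ident i G Gc Ge k _|ident G Gc Ge].
  by rewrite (ident G).
apply/matrixP => k i; have [ik|nik] := boolP (e i k).
  by apply: (ident i G) => //; rewrite inE.
by case: Gc => _ G_e; rewrite G_e // G0_e.
Qed.

(** * The certifying polynomial *)

(** The sum has the single term of the edge [(j, i)], or no term if [(j, i)] is
    not an edge. *)
Definition edge_mx (R : realType) (L : nat) (e : rel 'I_L) :
    'M[{mpoly R[#|edges e|]}]_L :=
  \matrix_(i, j) \sum_(x | enum_val x == (j, i)) 'X_x.

Lemma map_edge_mx (R : realType) (S : comNzRingType) (f : {rmorphism R -> S})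
    (L : nat) (e : rel 'I_L) (G : 'M[S]_L) :
  (forall i j, ~~ e j i -> G i j = 0) ->
  map_mx (mmap f (fun x => G (enum_val x).2 (enum_val x).1)) (edge_mx R e) = G.
Proof.
move=> G_e; apply/matrixP => i j; rewrite !mxE raddf_sum.
rewrite (eq_bigr (fun x => G (enum_val x).2 (enum_val x).1)); last first.
  by move=> x _; rewrite /= mmapX mmap1U.
rewrite -(@big_enum_val_cond _ _ _ _ (mem (edges e)) (fun x => x == (j, i))
           (fun x => G x.2 x.1)).
have [eji|neji] := boolP (e j i).
  rewrite (big_pred1 (j, i)) // => x /=.
  by case: eqP => [->|_]; rewrite ?andbF // inE eji.
rewrite G_e // big_pred0 // => x /=.
by case: eqP => [->|_]; rewrite ?andbF // inE /= (negPf neji).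
Qed.

(** The polynomial is the maximal minor of [test_mx N C (edge_mx R e)] in the
    rows that give full rank at [path_mx]; specializing the edge variables
    commutes with taking this minor. *)
Lemma paths_generically_full (R : realType) (L : nat) (e : rel 'I_L)
    (N C : {set 'I_L}) :
  disjoint_paths e N C ->
  exists2 p : {mpoly R[#|edges e|]}, p != 0 &
    forall G : 'M[tfun R]_L, consistent e G -> eval_edges p G != 0 ->
    row_full (test_mx N C G).
Proof.
move=> [s [sP s_disj]]; have full := path_mx_full R sP s_disj.
pose phi := fullrankfun full.
pose p := \det (rowsub phi (test_mx N C (edge_mx R e))).
have evalE (S : comNzRingType) (f : {rmorphism R -> S}) (G : 'M[S]_L) :
    (forall i j, ~~ e j i -> G i j = 0) ->
    mmap f (fun x => G (enum_val x).2 (enum_val x).1) p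
      = \det (rowsub phi (test_mx N C G)).
  by move=> G_e; rewrite -det_map_mx map_mxsub map_test_mx map_edge_mx.
exists p.
  have edge : forall i j, ~~ e j i -> path_mx R N s i j = 0.
    by apply: path_mx_edge => k /sP[].
  have := fullrowsub_unit full; rewrite unitmxE unitfE.
  rewrite -(evalE _ idfun _ edge); apply: contra_neq => ->; exact: mmap0.
move=> G [_ G_e]; rewrite /eval_edges (evalE _ (@tofrac _ \o polyC) _ G_e).
rewrite -unitfE -unitmxE -row_full_unit => /row_full_kerP inj.
apply/row_full_kerP => u Mu0; apply: inj.
by rewrite mul_rowsub_mx Mu0; apply/matrixP => a b; rewrite !mxE.
Qed.

(** * Nonzero polynomials at admissible networks *)

Lemma digits_inj (B n : nat) (f g : 'I_n -> nat) :
  (forall i, f i < B)%N -> (forall i, g i < B)%N ->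
  (\sum_i f i * B ^ i = \sum_i g i * B ^ i)%N -> f =1 g.
Proof.
elim: n f g => [|n IH] f g fB gB; first by move=> _ [].
have shift (h : 'I_n.+1 -> nat) :
    (\sum_i h i * B ^ i
      = (\sum_(i < n) h (lift ord0 i) * B ^ i) * B + h ord0)%N.
  rewrite big_ord_recl /= expn0 muln1 addnC big_distrl /=; congr (_ + _)%N.
  by apply: eq_bigr => i _; rewrite /bump /= add1n expnSr mulnA.
have B_gt0 : (0 < B)%N by apply: leq_ltn_trans (fB ord0).
rewrite !shift => eq_fg.
have eq0 : f ord0 = g ord0.
  have := congr1 (modn^~ B) eq_fg.
  by rewrite /= !modnMDl !modn_small.
have eqS : (fun i => f (lift ord0 i)) =1 (fun i => g (lift ord0 i)).
  apply: IH => //.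
  by move/eqP: eq_fg; rewrite eq0 eqn_add2r eqn_pmul2r // => /eqP.
by move=> i; case: (unliftP ord0 i) => [j ->|-> //]; apply: eqS.
Qed.

(** Kronecker substitution: with [k i = B ^ i] and [B] above all exponents of
    [p], distinct monomials go to distinct powers of [t], by uniqueness of
    digits in base [B]. *)
Lemma mpoly_kronecker (R : idomainType) (n : nat) (p : {mpoly R[n]}) :
  p != 0 ->
  exists (k : 'I_n -> nat) (P : {poly R}),
    [/\ forall i, (0 < k i)%N, P != 0 &
        forall t, P.[t] = p.@[fun i => t ^+ k i]].
Proof.
move=> p0; pose B := msize p.
have B_gt0 : (0 < B)%N by rewrite lt0n msize_poly_eq0.
pose code (m : 'X_{1..n}) := (\sum_i m i * B ^ i)%N.
have digit m i : m \in msupp p -> (m i < B)%N.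
  move/msize_mdeg_lt; apply: leq_ltn_trans.
  by rewrite mdegE (bigD1 i) //= leq_addr.
exists (fun i : 'I_n => B ^ i)%N, (\sum_(m <- msupp p) p@_m *: 'X^(code m)).
split=> [i||t]; first by rewrite expn_gt0 B_gt0.
- have supp := mlead_supp p0.
  apply/eqP => /(congr1 (coefp (code (mlead p)))) /=.
  rewrite coef0 coef_sum (bigD1_seq (mlead p)) ?msupp_uniq //= coefZ coefXn.
  rewrite eqxx mulr1 big_seq_cond big1 ?addr0 => [/eqP|m /andP[mp neq]].
    by move: supp; rewrite mcoeff_msupp => /negP.
  rewrite coefZ coefXn; case: eqP => [eq_code|_]; last by rewrite mulr0.
  case/eqP: neq; apply/mnmP => i; symmetry; move: i.
  by apply: (digits_inj (B := B)) => // i; apply: digit.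
- rewrite horner_sum mevalE; apply: eq_bigr => m _.
  rewrite hornerZ hornerXn; congr (_ * _); rewrite /code -prodrXr.
  by apply: eq_bigr => i _; rewrite mulnC exprM.
Qed.

(** The univariate polynomial of [mpoly_kronecker] has finitely many roots, so
    it is nonzero at some [delta / j.+1]; powers of that number with positive
    exponents are still small. *)
Lemma mpoly_small_nonroot (R : realFieldType) (n : nat) (p : {mpoly R[n]})
    (eps : R) :
  p != 0 -> 0 < eps ->
  exists2 a : 'I_n -> R, forall i, `|a i| <= eps & p.@[a] != 0.
Proof.
move=> /mpoly_kronecker[k [P [k_gt0 P0 PE]]] eps0.
pose delta := Num.min eps 1.
have delta0 : 0 < delta by rewrite lt_min eps0 ltr01.
pose t (j : nat) := delta / j.+1%:R.
have t_inj : injective t.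
  move=> i j /(mulfI (lt0r_neq0 delta0)) /invr_inj /eqP.
  by rewrite eqr_nat => /eqP[].
have [j Pj] : exists j, P.[t j] != 0.
  have : ~~ all (root P) [seq t j | j <- iota 0 (size P)].
    apply/negP => /(max_poly_roots P0).
    by rewrite map_inj_uniq // iota_uniq size_map size_iota ltnn => /(_ isT).
  by case/allPn => x /mapP[j _ ->]; exists j.
exists (fun i => t j ^+ k i); last by rewrite -PE.
have tj0 : 0 <= t j by rewrite divr_ge0 ?ltW // ler0n.
have tj_le : t j <= delta.
  by rewrite ler_pdivrMr ?ltr0n // ler_peMr ?ler1n // ltW.
have [d_eps d1] : delta <= eps /\ delta <= 1 by rewrite !ge_min !lexx orbT.
move=> i; rewrite normrX ger0_norm // -(prednK (k_gt0 i)) exprS.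
apply: le_trans (le_trans tj_le d_eps).
by rewrite ler_piMr // exprn_ile1 // (le_trans tj_le).
Qed.

Definition delayed (R : realType) (a : R) : tfun R := tofrac a%:P / tofrac 'X.

(** Multiplied by a power of the shift ['X], the value at the delayed
    weights becomes a polynomial in ['X], which takes the value [p.@[a]] at
    1. *)
Lemma eval_delayed (R : realType) (n : nat) (p : {mpoly R[n]}) (a : 'I_n -> R) :
  p.@[a] != 0 ->
  mmap (fun c : R => tofrac c%:P : tfun R) (fun i => delayed (a i)) p != 0.
Proof.
set v := mmap _ _ p => pa.
pose Q : {poly R} := \sum_(m <- msupp p)
  (p@_m * \prod_i a i ^+ m i) *: 'X^(msize p - mdeg m).
have X0 : tofrac 'X != 0 :> tfun R by rewrite tofrac_eq0 polyX_eq0.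
have vQ : v * tofrac 'X ^+ msize p = tofrac Q.
  rewrite /v /mmap mulr_suml rmorph_sum big_seq [RHS]big_seq.
  apply: eq_bigr => m /msize_mdeg_lt /ltnW m_le.
  rewrite -{1}(subnK m_le) exprD mulrACA.
  have -> : mmap1 (fun i => delayed (a i)) m * tofrac 'X ^+ mdeg m
      = tofrac (\prod_i a i ^+ m i)%:P.
    rewrite /mmap1 mdegE -prodrXr -big_split /= !rmorph_prod.
    apply: eq_bigr => i _.
    by rewrite -exprMn /delayed divfK // !rmorphXn.
  by rewrite -mul_polyC polyCM /= !tofracM tofracXn mulrAC.
apply: contraNneq pa => v0; rewrite v0 mul0r in vQ.
have /eqP := esym vQ; rewrite tofrac_eq0 => /eqP /(congr1 (horner^~ 1)) /=.
rewrite horner0 horner_sum => Q1; rewrite mevalE -[X in _ == X]Q1; apply/eqP.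
apply: eq_bigr => m _.
by rewrite hornerZ hornerXn expr1n mulr1.
Qed.

Lemma stable_fraction (R : realType) (n d : {poly R}) :
  d != 0 ->
  (forall z : R[i], root (map_poly (real_complex R) d) z -> `|z| < 1) ->
  stable_tf (tofrac n / tofrac d).
Proof.
move=> d0 d_stable; pose g := gcdp n d.
have g0 : g != 0 by rewrite gcdp_eq0 negb_and d0 orbT.
have nE : n %/ g * g = n by rewrite divpK ?dvdp_gcdl.
have dE : d %/ g * g = d by rewrite divpK ?dvdp_gcdr.
exists (n %/ g), (d %/ g); split.
- by apply: contraNneq d0 => d'0; rewrite -dE d'0 mul0r.
- by rewrite coprimep_div_gcd // d0 orbT.
- by rewrite -{1}nE -{1}dE !tofracM -mulf_div divff ?mulr1 ?tofrac_eq0.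
- by move=> z dz; apply: d_stable; rewrite -dE rmorphM rootM dz.
Qed.

(** If [v *m A = z *: v], summing the absolute values of the coordinates gives
    [`|z| * S <= c * S], where [S > 0] is the sum of the [`|v 0 i|]. *)
Lemma char_poly_roots_small (R : realType) (L : nat) (A : 'M[R]_L) (c : R) :
  c < 1 -> (forall i, \sum_j `|A i j| <= c) ->
  forall z : R[i],
    root (map_poly (real_complex R) (char_poly A)) z -> `|z| < 1.
Proof.
move=> c1 A_le z; rewrite map_char_poly -eigenvalue_root_char.
case/eigenvalueP=> v vA v0.
pose S := \sum_i `|v 0 i|.
have S0 : 0 < S.
  rewrite lt_neqAle sumr_ge0 // andbT eq_sym.
  apply: contraNneq v0 => /eqP; rewrite psumr_eq0 // => /allP v_eq0.
  apply/eqP/rowP => i; rewrite mxE; apply/eqP; rewrite -normr_eq0.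
  by apply: v_eq0; rewrite mem_index_enum.
apply: (@le_lt_trans _ _ (real_complex R c)); last first.
  by rewrite -(rmorph1 (real_complex R)) ltcR.
rewrite -(ler_pM2r S0) mulr_sumr.
rewrite (eq_bigr (fun j => `|\sum_i v 0 i * real_complex R (A i j)|));
  last first.
  move=> j _; have := congr1 (fun w : 'rV_L => w 0 j) vA; rewrite !mxE => vAj.
  by rewrite -normrM -vAj; congr `|_|; apply: eq_bigr => i _; rewrite mxE.
apply: le_trans (ler_sum _ (fun j _ => ler_norm_sum _ _ _)) _.
rewrite exchange_big /= mulr_sumr ler_sum // => i _.
under eq_bigr do rewrite normrM.
rewrite -mulr_sumr mulrC ler_wpM2r //.
apply: (@le_trans _ _ (real_complex R (\sum_j `|A i j|))); last by rewrite lecR.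
rewrite rmorph_sum ler_sum // => j _.
by rewrite normc_def /= expr0n addr0 sqrtr_sqr.
Qed.

Lemma size_det_le (R : idomainType) (n : nat) (M : 'M[{poly R}]_n) :
  (forall i j, (size (M i j) <= 2)%N) -> (size (\det M) <= n.+1)%N.
Proof.
move=> M2; apply: leq_trans (size_sum _ _ _) _.
apply/bigmax_leqP => s _; rewrite size_Msign.
apply: leq_trans (size_prod_leq _ _) _; rewrite card_ord leq_subLR addnS ltnS.
rewrite addnn -muln2 -[X in (X * 2)%N]card_ord -sum_nat_const.
exact: leq_sum.
Qed.

(** Here [1 - G = (q - A) / q], so the closed loop is
    [q *: \adj (q - A) / char_poly A].  It is proper because cofactors of
    [q - A] have degree at most [L - 1], and its poles are among the
    eigenvalues of [A]. *)
Lemma delayed_admissible (R : realType) (L : nat) (e : rel 'I_L) (A : 'M[R]_L)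
    (c : R) :
  (forall i j, ~~ e j i -> A i j = 0) ->
  c < 1 -> (forall i, \sum_j `|A i j| <= c) ->
  admissible e (map_mx (@delayed R) A).
Proof.
move=> A_e c1 A_le; set G := map_mx _ A.
have X0 : tofrac 'X != 0 :> tfun R by rewrite tofrac_eq0 polyX_eq0.
have G_sproper i j : strictly_proper_tf (G i j).
  exists (A i j)%:P, 'X; rewrite polyX_eq0 size_polyX mxE; split=> //.
  exact: leq_ltn_trans (size_polyC_leq1 _) _.
have G_proper i j : proper_tf (G i j).
  by have [n [d [? ? /ltnW]]] := G_sproper i j; exists n, d.
pose M := char_poly_mx A; pose chi := char_poly A.
have chi_neq0 : chi != 0 by rewrite monic_neq0 // char_poly_monic.
have chi0 : tofrac chi != 0 :> tfun R by rewrite tofrac_eq0.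
have GE : 1%:M - G = (tofrac 'X)^-1 *: map_mx (@tofrac _) M.
  apply/matrixP => i j; rewrite !mxE tofracB mulrBr; congr (_ - _).
    case: (i == j); last by rewrite !mulr0n tofrac0 mulr0.
    by rewrite !mulr1n (mulVf X0).
  by rewrite /delayed mulrC.
pose W := (tofrac 'X / tofrac chi) *: map_mx (@tofrac _) (\adj M).
have GW : (1%:M - G) *m W = 1%:M.
  rewrite GE -scalemxAl -scalemxAr scalerA (mulKf X0) -map_mxM mul_mx_adj.
  by rewrite map_scalar_mx scale_scalar_mx (mulVf chi0).
have [uG _] := mulmx1_unit GW.
have closedE : closed_loop G = W.
  by have := mulKmx uG W; rewrite GW mulmx1.
split=> //.
- by split=> // i j /A_e; rewrite mxE => ->; rewrite /delayed tofrac0 mul0r.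
- by move=> [//|x s] _ _; exists x; rewrite ?inE ?eqxx.
move=> i j; rewrite closedE.
have -> : W i j = tofrac ('X * \adj M i j) / tofrac chi.
  by rewrite mxE [X in _ * X = _]mxE mulrAC -tofracM.
split; last first.
  by apply: (stable_fraction _ chi_neq0); apply: char_poly_roots_small c1 A_le.
exists ('X * \adj M i j), chi; split; [exact: chi_neq0|by []|].
rewrite size_char_poly.
have L0 : (0 < L)%N by apply: leq_ltn_trans (ltn_ord i).
apply: leq_trans (size_polyMleq _ _) _; rewrite size_polyX /= ltnS mxE.
rewrite /cofactor size_Msign -[leqRHS](prednK L0); apply: size_det_le => k l.
rewrite !mxE; case: (_ == _); first by rewrite mulr1n size_XsubC.
by rewrite mulr0n sub0r size_polyN (leq_trans (size_polyC_leq1 _)).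
Qed.

Lemma generic_point (R : realType) (L : nat) (e : rel 'I_L)
    (p : {mpoly R[#|edges e|]}) :
  p != 0 -> exists2 G : 'M[tfun R]_L, admissible e G & eval_edges p G != 0.
Proof.
move=> p0; pose eps : R := L.+1%:R^-1.
have eps0 : 0 < eps by rewrite invr_gt0 ltr0n.
have [a a_le pa] := mpoly_small_nonroot p0 eps0.
pose A : 'M[R]_L := \matrix_(i, j) \sum_(x | enum_val x == (j, i)) a x.
have A_entry x : A (enum_val x).2 (enum_val x).1 = a x.
  rewrite mxE -surjective_pairing (big_pred1 x) // => y.
  by rewrite (inj_eq enum_val_inj).
have A_e i j : ~~ e j i -> A i j = 0.
  move=> neji; rewrite mxE big_pred0 // => x; apply: contraNF neji => /eqP xji.
  by have := enum_valP x; rewrite xji inE.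
have A_le i j : `|A i j| <= eps.
  have [eji|/A_e ->] := boolP (e j i); last by rewrite normr0 ltW.
  have ji : (j, i) \in edges e by rewrite inE.
  have := A_entry (enum_rank_in ji (j, i)); rewrite enum_rankK_in // => ->.
  exact: a_le.
exists (map_mx (@delayed R) A).
  apply: (delayed_admissible (c := L%:R * eps)) => // [|i].
    by rewrite ltr_pdivrMr ?ltr0n // mul1r ltr_nat.
  apply: le_trans (ler_sum _ (fun j _ => A_le i j)) _.
  by rewrite sumr_const card_ord mulr_natl.
have := eval_delayed pa; congr (_ != 0); apply: eq_bigr => m _.
congr (_ * _); apply: eq_bigr => x _; congr (_ ^+ _).
by rewrite mxE A_entry.
Qed.

Theorem theoremV4 (R : realType) (L : nat) (e : rel 'I_L) (C : {set 'I_L})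
    (e_irr : irreflexive e) :
  (forall i : 'I_L,
     generically e (fun G0 : 'M[tfun R]_L => identifiable_from e C i G0) <->
     disjoint_paths e (out_nbrs e i) C) /\
  (generically e (fun G0 : 'M[tfun R]_L => identifiable e C G0) <->
   forall i : 'I_L, disjoint_paths e (out_nbrs e i) C).
Proof.
have from_paths i : disjoint_paths e (out_nbrs e i) C ->
    exists2 p : {mpoly R[#|edges e|]}, p != 0 &
      forall G, admissible e G -> eval_edges p G != 0 ->
      identifiable_from e C i G.
  move=> /(paths_generically_full R)[p p0 pP]; exists p => // G [Gc _ uG _] pG.
  exact: full_identifiable_from (pP G Gc pG).
have to_paths i G : admissible e G -> identifiable_from e C i G ->
    disjoint_paths e (out_nbrs e i) C.
  move=> [Gc _ uG _] /(identifiable_from_full uG Gc).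
  by apply: full_test_mx_paths; case: Gc.
split=> [i|]; split.
- move=> [p [p0 pP]]; have [G Ga /(pP G Ga)] := generic_point p0.
  exact: to_paths.
- by move=> /from_paths[p p0 pP]; exists p.
- move=> [p [p0 pP]] i; have [G Ga /(pP G Ga)] := generic_point p0.
  have [Gc _ _ _] := Ga.
  by move=> /(identifiable_columns C Gc)/(_ i); apply: to_paths.
- move=> paths.
  have [p pP] := fin_all_exists2 (fun i => from_paths i (paths i)).
  move=> p_ident; exists (\prod_i p i); split; first exact/prodf_neq0.
  move=> G Ga; rewrite /eval_edges (rmorph_prod (mmap (@tofrac _ \o polyC) _)).
  move=> /prodf_neq0 pG; have [Gc _ _ _] := Ga.
  by apply/(identifiable_columns C Gc) => i; apply: p_ident => //; apply: pG.
Qed.
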